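(* Let $N\ge1$ and let $(\mathbb{R}^N,\mathbb{R},\mathcal{L})$ be a cut and project scheme with $\mathcal{L}=A(\mathbb{Z}^{N+1})$, $A=(a_{i,j})_{i,j=1}^{N+1}\in\mathrm{GL}(N+1,\mathbb{R})$, normalized so that $a_{N+1,j}\in(0,1)$ for $j=1,\ldots,N$ and $a_{N+1,N+1}=1$. Let the points $l_v,l_v^*$ ($v\in\mathbb{Z}^N$), the numbering $(v(n))_{n\in\mathbb{N}}$ of $\mathbb{Z}^N$, the sequences $(n_k)_{k\in\mathbb{N}}$ and $(\varepsilon_k)_{k\in\mathbb{N}}$, the intervals $I_k=(l^*_{v(n_k)},l^*_{v(n_k)}+\varepsilon_k)$, the Cantor set $C_0=[0,1]\setminus\bigcup_kI_k$ and the sets $A_k\subseteq[0,1]$ with empty interior be as described in the context, and define the window (of empty interior) $$W\ =\ C_0\cup\bigcup_{k\in\mathbb{N}}\bigl(I_k\cap(\inf(I_k)+A_k)\bigr).$$ Let $S=\{l_{v(n_k)}\mid k\in\mathbb{N}\}$. Then for almost all $\vartheta\in\mathbb{R}$ the hull $\Omega(\curlywedge(W+\vartheta))$ contains an embedded fullshift and $(\Omega(\curlywedge(W+\vartheta)),\mathbb{R}^N)$ has positive topological entropy.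
   Context: Cut and project scheme here: $\mathcal{L}=A(\mathbb{Z}^{N+1})\subseteq\mathbb{R}^N\times\mathbb{R}$ is a lattice such that $\pi_1:\mathbb{R}^N\times\mathbb{R}\to\mathbb{R}^N$ is injective on $\mathcal{L}$ and $\pi_2:\mathbb{R}^N\times\mathbb{R}\to\mathbb{R}$ maps $\mathcal{L}$ to a dense set $L^*=\pi_2(\mathcal{L})$. For relatively compact $W\subseteq\mathbb{R}$, $\curlywedge(W)=\pi_1(\mathcal{L}\cap(\mathbb{R}^N\times W))$. Points $l_v,l_v^*$: for $v=(v_1,\ldots,v_N)\in\mathbb{Z}^N$ there is a unique $v_{N+1}\in\mathbb{Z}$ with $l_v^*:=\sum_{j=1}^{N+1}a_{N+1,j}v_j\in[0,1)$; thus $l_v^*\in L^*$, and $l_v$ is the unique point with $(l_v,l_v^* )\in\mathcal{L}$ given by $(l_v,l_v^* )=A(v,v_{N+1})^{T}$. Fix a numbering $(v(n))_{n\in\mathbb{N}}$ of $\mathbb{Z}^N$ such that $\|v(n)\|_\infty$ is non-decreasing in $n$. Sequences: $(n_k)_{k\in\mathbb{N}}\subseteq\mathbb{N}$ is increasing and $\varepsilon_k>0$ are such that the open intervals $I_k=(l^*_{v(n_k)},l^*_{v(n_k)}+\varepsilon_k)$ satisfy (i) $I_j\cap I_k=\emptyset$ for $j\ne k$; (ii) $\mathrm{cl}(\bigcup_kI_k)=[0,1]$; (iii) $\lim_{k\to\infty}k/n_k>1/2$. Sets $A_k$: let $C$ be the middle third Cantor set; $(A_k)_{k\in\mathbb{N}}$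 is a sequence of (Lebesgue measurable) subsets of $[0,1]$ such that $C\subseteq\partial A_k$ and $\mathrm{int}(A_k)=\emptyset$ for all $k$, and the family is locally metrically independent in $0$: for every finite $F\subseteq\mathbb{N}$, $a\in\{0,1\}^F$ and $\varepsilon>0$, the set $(-\varepsilon,\varepsilon)\cap\bigl(\bigcap_{s\in F:a_s=1}A_s\setminus\bigcup_{s\in F:a_s=0}A_s\bigr)$ has positive Lebesgue measure (an empty intersection being $\mathbb{R}$). Hull: the space of closed subsets of $\mathbb{R}^N$ (including $\emptyset$) carries the compact metric $d(\Lambda_1,\Lambda_2)=d_H(j^{-1}(\Lambda_1\cup\{\infty\}),j^{-1}(\Lambda_2\cup\{\infty\}))$, where $j:\mathbb{S}^N\to\mathbb{R}^N\cup\{\infty\}$ is stereographic projection and $d_H$ the Hausdorff metric on compact subsets of $\mathbb{S}^N$. For uniformly discrete $\Lambda$ (distinct points at distance $\ge r$ for some $r>0$), $\Omega(\Lambda)=\mathrm{cl}\{\Lambda-s\mid s\in\mathbb{R}^N\}$ with action $\varphi_s(\Gamma)=\Gamma-s$; the hull may contain $\emptyset$. Embedded fullshift: with $F_t=[-t,t]^N$ and Lebesgue measure $\lambda$, $\nu_S=\limsup_{t\to\infty}\sharp(S\cap F_t)/\lambda(F_t)$. An embedded fullshift in $\Omega(\Lambda)$ is a pair $(\Xi,S)$ with $\Xi\subseteq\Omega(\Lambda)$ closed and $S\subseteq\mathbb{R}^N$ such that $\nu_S>0$, the set $\bigcup_{\Gamma\in\Xi}\Gamma$ is uniformly discrete,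 and for every $S'\subseteq S$ there is $\Gamma\in\Xi$ with $\Gamma\cap S=S'$; then $\Omega(\Lambda)$ is said to contain an embedded fullshift. Topological entropy of an $\mathbb{R}^N$-action $\phi$ on a compact metric space $(X,d)$: $Y\subseteq X$ is $(\varepsilon,t)$-separated if $\max_{s\in F_t}d(\phi_s(x),\phi_s(x'))\ge\varepsilon$ for all distinct $x,x'\in Y$; $N(\phi,\varepsilon,t)$ is the maximal cardinality of such a set; $h_{\mathrm{top}}(\phi)=\sup_{\varepsilon>0}\limsup_{t\to\infty}\frac{1}{\lambda(F_t)}\log N(\phi,\varepsilon,t)$. *)

(* Defs.v *)
From HB Require Import structures.
From mathcomp Require Import all_boot all_order all_algebra.
From mathcomp Require Import finmap.
From mathcomp Require Import all_classical all_reals all_analysis measurable_realfun.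
From mathcomp Require Import ring lra.

Set Implicit Arguments.
Unset Strict Implicit.
Unset Printing Implicit Defensive.
Set SsrOldRewriteGoalsOrder.

Import Order.TTheory GRing.Theory Num.Theory.
Import numFieldNormedType.Exports numFieldTopology.Exports.

Local Open Scope classical_set_scope.
Local Open Scope ring_scope.

(* The library norm on 'cV[R]_m is the sup norm; distances in R^N and on the
   sphere are Euclidean. *)
Definition enorm (R : realType) (m : nat) (x : 'cV[R]_m) : R :=
  Num.sqrt (\sum_i x i 0 ^+ 2).

Section EuclideanNorm.
Context {R : realType} {m : nat}.
Implicit Types x y z : 'cV[R]_m.

Lemma enorm_ge0 x : 0 <= enorm x.
Proof. exact: sqrtr_ge0. Qed.

Lemma sqr_enorm x : enorm x ^+ 2 = \sum_i x i 0 ^+ 2.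
Proof. by rewrite sqr_sqrtr// sumr_ge0// => i _; rewrite sqr_ge0. Qed.

Lemma enorm0 : enorm (0 : 'cV[R]_m) = 0.
Proof.
by rewrite /enorm big1 ?sqrtr0// => i _; rewrite mxE expr0n.
Qed.

Lemma enormN x : enorm (- x) = enorm x.
Proof. by rewrite /enorm; under eq_bigr do rewrite mxE sqrrN. Qed.

Lemma coord_le_enorm x i : `|x i 0| <= enorm x.
Proof.
rewrite -(ler_pXn2r (ltn0Sn 1)) ?nnegrE ?enorm_ge0// sqr_enorm real_normK ?num_real//.
by rewrite (bigD1 i)//= lerDl sumr_ge0// => j _; rewrite sqr_ge0.
Qed.

Lemma enorm_eq0 x : enorm x = 0 -> x = 0.
Proof.
move=> x0; apply/matrixP => i j; rewrite ord1 mxE; apply/eqP.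
by rewrite -normr_le0 -x0 coord_le_enorm.
Qed.

Lemma enorm_dot x y : \sum_i x i 0 * y i 0 <= enorm x * enorm y.
Proof.
have [x0|x0] := eqVneq (enorm x) 0.
  by rewrite x0 mul0r (enorm_eq0 x0) big1// => i _; rewrite mxE mul0r.
have [y0|y0] := eqVneq (enorm y) 0.
  by rewrite y0 mulr0 (enorm_eq0 y0) big1// => i _; rewrite mxE mulr0.
have a0 : 0 < enorm x by rewrite lt_def x0 enorm_ge0.
have b0 : 0 < enorm y by rewrite lt_def y0 enorm_ge0.
have : 0 <= \sum_i (enorm y * x i 0 - enorm x * y i 0) ^+ 2.
  by rewrite sumr_ge0// => i _; rewrite sqr_ge0.
have -> : \sum_i (enorm y * x i 0 - enorm x * y i 0) ^+ 2 =
    2 * (enorm x * enorm y) * (enorm x * enorm y - \sum_i x i 0 * y i 0).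
  rewrite mulrBr [X in X - _](_ : _ = enorm y ^+ 2 * \sum_i x i 0 ^+ 2
     + enorm x ^+ 2 * \sum_i y i 0 ^+ 2); last by rewrite -!sqr_enorm; ring.
  rewrite !mulr_sumr -big_split -sumrB/=; apply: eq_bigr => i _; ring.
by rewrite pmulr_rge0 ?subr_ge0// mulr_gt0// mulr_gt0.
Qed.

Lemma ler_enormD x y : enorm (x + y) <= enorm x + enorm y.
Proof.
rewrite -(ler_pXn2r (ltn0Sn 1)) ?nnegrE ?addr_ge0 ?enorm_ge0//.
rewrite sqrrD !sqr_enorm (eq_bigr (fun i => x i 0 ^+ 2 +
  2 * (x i 0 * y i 0) + y i 0 ^+ 2)); last by move=> i _; rewrite !mxE; ring.
rewrite !big_split/= lerD2r lerD2l -mulr_sumr -[leRHS]mulr_natl.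
by rewrite ler_pM2l// enorm_dot.
Qed.

Lemma ler_enormB x y z : enorm (x - z) <= enorm (x - y) + enorm (y - z).
Proof. by rewrite (le_trans _ (ler_enormD _ _))// subrKA. Qed.

Lemma enormBC x y : enorm (x - y) = enorm (y - x).
Proof. by rewrite -enormN opprB. Qed.

End EuclideanNorm.

Section HausdorffDistance.
Context {R : realType} {m : nat}.
Implicit Types (x y : 'cV[R]_m) (K : set 'cV[R]_m).

Definition dist_to x K : R := inf [set enorm (x - y) | y in K].

Definition hausdorff_dist K1 K2 : R :=
  Num.max (sup [set dist_to x K2 | x in K1]) (sup [set dist_to y K1 | y in K2]).

Let excess K1 K2 : R := sup [set dist_to x K2 | x in K1].

Lemma hausdorff_distC K1 K2 : hausdorff_dist K1 K2 = hausdorff_dist K2 K1.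
Proof. by rewrite /hausdorff_dist maxC. Qed.

Lemma dist_to_le x y K : K y -> dist_to x K <= enorm (x - y).
Proof.
move=> Ky; apply: ge_inf; last by exists y.
by exists 0 => _ [z _ <-]; exact: enorm_ge0.
Qed.

Lemma dist_to_ge0 x K : K !=set0 -> 0 <= dist_to x K.
Proof.
move=> [y Ky]; apply: lb_le_inf; first by exists (enorm (x - y)), y.
by move=> _ [z _ <-]; exact: enorm_ge0.
Qed.

Lemma dist_to_triangle x y K : K !=set0 ->
  dist_to x K <= enorm (x - y) + dist_to y K.
Proof.
move=> [z0 Kz0]; rewrite -lerBlDl; apply: lb_le_inf.
  by exists (enorm (y - z0)), z0.
move=> _ [z Kz <-]; rewrite lerBlDl.
by rewrite (le_trans (dist_to_le _ Kz))// ler_enormB.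
Qed.

Lemma dist_to_mem x K : K x -> dist_to x K = 0.
Proof.
move=> Kx; apply/eqP; rewrite eq_le dist_to_ge0 ?andbT; last by exists x.
by rewrite (le_trans (dist_to_le x Kx))// subrr enorm0.
Qed.

Context (r : R).
Let bnd K := K !=set0 /\ forall x, K x -> enorm x <= r.

Let excess_ub K1 K2 x : bnd K1 -> bnd K2 -> K1 x ->
  dist_to x K2 <= excess K1 K2.
Proof.
move=> [_ b1] [[y K2y] b2] K1x; apply: ub_le_sup; last by exists x.
exists (r + r) => _ [z K1z <-]; rewrite (le_trans (dist_to_le z K2y))//.
rewrite (le_trans (ler_enormD _ _))// enormN; apply: lerD; [exact: b1|exact: b2].
Qed.

Let excess_triangle K1 K2 K3 : bnd K1 -> bnd K2 -> bnd K3 ->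
  excess K1 K3 <= excess K1 K2 + excess K2 K3.
Proof.
move=> B1 B2 B3; apply: ge_sup.
  by have [[x K1x] _] := B1; exists (dist_to x K3), x.
move=> _ [x K1x <-].
rewrite -lerBlDr (le_trans _ (excess_ub B1 B2 K1x))//.
have [[y0 K2y0] _] := B2.
apply: lb_le_inf; first by exists (enorm (x - y0)), y0.
move=> _ [y K2y <-]; rewrite lerBlDr.
rewrite (le_trans (dist_to_triangle x y B3.1))// lerD2l.
exact: excess_ub.
Qed.

Let excess_refl K : K !=set0 -> excess K K = 0.
Proof.
move=> [x Kx]; rewrite /excess (_ : [set _ | _ in _] = [set 0]) ?sup1//.
apply/seteqP; split => [_ [y Ky <-]|_ ->] /=; first exact: dist_to_mem.
by exists x => //; exact: dist_to_mem.
Qed.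

Lemma hausdorff_dist_refl K : K !=set0 -> hausdorff_dist K K = 0.
Proof. by move=> K0; rewrite /hausdorff_dist -/(excess _ _) excess_refl// maxxx. Qed.

Lemma hausdorff_dist_triangle K1 K2 K3 :
  K1 !=set0 -> K2 !=set0 -> K3 !=set0 ->
  (forall x, (K1 `|` K2 `|` K3) x -> enorm x <= r) ->
  hausdorff_dist K1 K3 <= hausdorff_dist K1 K2 + hausdorff_dist K2 K3.
Proof.
move=> K10 K20 K30 b.
have B1 : bnd K1 by split => // x Kx; apply: b; left; left.
have B2 : bnd K2 by split => // x Kx; apply: b; left; right.
have B3 : bnd K3 by split => // x Kx; apply: b; right.
rewrite {1}/hausdorff_dist -/(excess _ _) -/(excess _ _) ge_max; apply/andP; split.
  rewrite (le_trans (excess_triangle B1 B2 B3))// lerD//.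
    by rewrite /hausdorff_dist le_max lexx.
  by rewrite /hausdorff_dist le_max lexx.
rewrite (le_trans (excess_triangle B3 B2 B1))// addrC lerD//.
  by rewrite /hausdorff_dist le_max lexx orbT.
by rewrite /hausdorff_dist le_max lexx orbT.
Qed.

Lemma hausdorff_dist0_near K1 K2 x e : K1 !=set0 -> K2 !=set0 ->
  (forall z, (K1 `|` K2) z -> enorm z <= r) ->
  hausdorff_dist K1 K2 = 0 -> K1 x -> 0 < e ->
  exists2 y, K2 y & enorm (x - y) < e.
Proof.
move=> K10 K20 b d0 K1x e0.
have B1 : bnd K1 by split => // z Kz; apply: b; left.
have B2 : bnd K2 by split => // z Kz; apply: b; right.
have h : dist_to x K2 < e.
  rewrite (le_lt_trans _ e0)// -d0 /hausdorff_dist le_max.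
  by rewrite -/(excess _ _) excess_ub.
have [|_ [y K2y <-] yb] := inf_lt _ h; last by exists y.
by have [y K2y] := K20; exists (enorm (x - y)), y.
Qed.

End HausdorffDistance.

(* R^N x R is represented by 'cV[R]_(N + 1). *)
Definition pi1 (R : realType) (N : nat) (x : 'cV[R]_(N + 1)) : 'cV[R]_N :=
  usubmx x.

Definition pi2 (R : realType) (N : nat) (x : 'cV[R]_(N + 1)) : R :=
  dsubmx x 0 0.

Section Stereographic.
Context {R : realType} {N : nat}.

Definition sphere : set 'cV[R]_(N + 1) := [set p | enorm p = 1].

(* Projection from the north pole p_{N+1} = 1, which is sent to infinity
   ([None] is the point at infinity of the library's compactification), onto
   the equatorial hyperplane. *)
Definition stereo (p : 'cV[R]_(N + 1)) :
    one_point_compactification 'cV[R]_N :=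
  if pi2 p == 1 then None else Some ((1 - pi2 p)^-1 *: pi1 p).

Definition sphere_lift (L : set 'cV[R]_N) : set 'cV[R]_(N + 1) :=
  sphere `&` stereo @^-1` ([set Some x | x in L] `|` [set None]).

Lemma sphere_lift_neq0 L : sphere_lift L !=set0.
Proof.
exists (col_mx 0 1%:M); split; rewrite /sphere/=.
  rewrite /enorm big_split_ord/= big1 ?add0r; last first.
    by move=> i _; rewrite col_mxEu mxE expr0n.
  by rewrite big_ord1 col_mxEd mxE eqxx expr1n sqrtr1.
by right; rewrite /stereo /pi2 col_mxKd mxE !eqxx.
Qed.

Lemma stereo_surj (x : 'cV[R]_N) :
  exists p, [/\ enorm p = 1, pi2 p != 1 & stereo p = Some x].
Proof.
pose q := \sum_i x i 0 ^+ 2.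
have q0 : 0 <= q by rewrite sumr_ge0// => i _; rewrite sqr_ge0.
have q1 : q + 1 != 0 by rewrite gt_eqF// ltr_wpDl.
pose p : 'cV[R]_(N + 1) :=
  col_mx ((2 / (q + 1)) *: x) ((q - 1) / (q + 1))%:M.
have p2 : pi2 p = (q - 1) / (q + 1).
  by rewrite /pi2 /p col_mxKd mxE eqxx mulr1n.
have p21 : 1 - pi2 p = 2 / (q + 1) by rewrite p2; field.
have p2n : pi2 p != 1.
  by rewrite -subr_eq0 -oppr_eq0 opprB p21 mulf_neq0// ?invr_eq0// pnatr_eq0.
exists p; split => //.
  rewrite /enorm -[RHS]sqrtr1; congr Num.sqrt.
  rewrite big_split_ord/= big_ord1 /p col_mxEd !mxE eqxx mulr1n.
  under eq_bigr do rewrite col_mxEu mxE exprMn.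
  by rewrite -mulr_sumr -/q; field.
rewrite /stereo (negbTE p2n) p21 /pi1 /p col_mxKu scalerA mulVf ?scale1r//.
by rewrite mulf_neq0// ?invr_eq0// pnatr_eq0.
Qed.

Lemma stereo_continuous (p : 'cV[R]_(N + 1)) (x : 'cV[R]_N) (V : set 'cV[R]_N) :
  stereo p = Some x -> nbhs x V ->
  exists2 e, 0 < e & forall q, enorm (p - q) < e ->
    exists2 y, stereo q = Some y & V y.
Proof.
rewrite /stereo; case: eqP => // /eqP p1 [<-{x}] [B /= Bx BV].
have cp2 : pi2 q @[q --> p] --> pi2 p.
  have -> : @pi2 R N = fun q => q (rshift N 0) 0.
    by apply/funext => q; rewrite /pi2 mxE.
  exact: coord_continuous.
have p0 : 1 - pi2 p != 0 by rewrite subr_eq0 eq_sym.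
have cs i j : (1 - pi2 q)^-1 * q (lshift 1 i) j @[q --> p] -->
    (1 - pi2 p)^-1 * p (lshift 1 i) j.
  suff cvgF (F : set_system 'cV[R]_(N + 1)) : Filter F ->
      pi2 q @[q --> F] --> pi2 p ->
      q (lshift 1 i) j @[q --> F] --> p (lshift 1 i) j ->
      (1 - pi2 q)^-1 * q (lshift 1 i) j @[q --> F] -->
      (1 - pi2 p)^-1 * p (lshift 1 i) j.
    apply: cvgF; [exact: nbhs_filter|exact: cp2|exact: (@coord_continuous _ _ _ _ _ p)].
  move=> FF F2 Fi; apply: cvgM => //; apply: cvgV => //.
  by apply: cvgB => //; exact: cvg_cst.
have : \forall q \near p, pi2 q != 1 /\
    forall i j, B i j ((1 - pi2 q)^-1 * q (lshift 1 i) j).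
  apply: filterI.
    have n1 : nbhs (pi2 p) [set x : R | x != 1].
      by apply: open_nbhs_nbhs; split; [exact: open_neq|].
    exact: (cp2 _ n1).
  apply: (filter_forall (F := nbhs p)) => i.
  apply: (filter_forall (F := nbhs p)) => j.
  by have := Bx i j; rewrite !mxE => /cs.
move=> [C /= Cp CP].
have Ce : \forall e \near (0:R)^'+,
    forall i j, forall y, `|p i j - y| < e -> C i j y.
  apply: filter_forall => i; apply: filter_forall => j.
  have /nbhs_ballP[e /= e0 eC] := Cp i j.
  apply: filterS (nbhs_right_lt e0) => d de y yd.
  by apply: eC; rewrite /ball/= (lt_trans yd).
near (0:R)^'+ => e.
exists e => // q pq.
have /CP[q1 Bq] : forall i j, C i j (q i j).
  move=> i j; have Ce' : forall i j, forall y, `|p i j - y| < e -> C i j y by near: e.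
  apply: Ce'; rewrite ord1 (le_lt_trans _ pq)//.
  by have := coord_le_enorm (p - q) i; rewrite !mxE.
exists ((1 - pi2 q)^-1 *: pi1 q); first by rewrite (negbTE q1).
by apply: BV => i j; rewrite !mxE.
Unshelve. all: by end_near. Qed.

End Stereographic.

Record closed_subset (R : realType) (N : nat) := ClosedSubset {
  closed_subset_val :> set 'cV[R]_N ;
  closed_subsetP : closed closed_subset_val }.
Arguments ClosedSubset {R N}.

Lemma closed_subset_inj (R : realType) (N : nat) :
  injective (@closed_subset_val R N).
Proof.
move=> [A cA] [B cB] /= AB; subst B; congr ClosedSubset.
exact: Prop_irrelevance.
Qed.

HB.instance Definition _ (R : realType) (N : nat) :=
  gen_eqMixin (closed_subset R N).
HB.instance Definition _ (R : realType) (N : nat) :=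
  gen_choiceMixin (closed_subset R N).

Section ClosedSubsetMetric.
Context {R : realType} {N : nat}.
Implicit Types L : closed_subset R N.

Definition closed_subset_dist L1 L2 : R :=
  hausdorff_dist (sphere_lift L1) (sphere_lift L2).

Let distxx L : closed_subset_dist L L = 0.
Proof. by apply: hausdorff_dist_refl; exact: sphere_lift_neq0. Qed.

Let dist_sym L1 L2 : closed_subset_dist L1 L2 = closed_subset_dist L2 L1.
Proof. exact: hausdorff_distC. Qed.

Let dist_triangle L2 L1 L3 :
  closed_subset_dist L1 L3 <= closed_subset_dist L1 L2 + closed_subset_dist L2 L3.
Proof.
apply: (@hausdorff_dist_triangle _ _ 1); try exact: sphere_lift_neq0.
by move=> x [[|]|] [-> _].
Qed.

Let dist0_sub L1 L2 : closed_subset_dist L1 L2 = 0 -> L1 `<=` L2.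
Proof.
move=> d0 x L1x.
have [p [p1 pn px]] := stereo_surj x.
have L1p : sphere_lift L1 p by split => //=; left; exists x.
rewrite [X in X x](closure_id L2).1; last exact: closed_subsetP.
move=> V /(stereo_continuous px)[e e0 eV].
have [|q [_ Lq] pq] := @hausdorff_dist0_near _ _ 1 _ _ p e
  (sphere_lift_neq0 L1) (sphere_lift_neq0 L2) _ d0 L1p e0.
  by move=> z [|] [-> _].
have [y qy Vy] := eV _ pq.
by move: Lq => [[z L2z]|] /=; rewrite qy// => -[zy]; exists y; rewrite -zy in Vy *.
Qed.

Let dist_positivity L1 L2 : closed_subset_dist L1 L2 = 0 -> L1 = L2.
Proof.
move=> d0; apply: closed_subset_inj; apply/seteqP; split; first exact: dist0_sub.
by apply: dist0_sub; rewrite dist_sym.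
Qed.

HB.instance Definition _ := isMetric.Build R (closed_subset R N)
  distxx dist_positivity dist_sym dist_triangle.

End ClosedSubsetMetric.

Section Hull.
Context {R : realType} {N : nat}.
Implicit Types (s : 'cV[R]_N) (L : set 'cV[R]_N).

Definition translate s L : set 'cV[R]_N := [set x - s | x in L].

Lemma closed_translate s L : closed L -> closed (translate s L).
Proof.
move=> cL; rewrite (_ : translate s L = (fun x => x + s) @^-1` L); last first.
  apply/seteqP; split => [_ [x Lx <-]|x Lx] /=; first by rewrite subrK.
  by exists (x + s) => //; rewrite addrK.
apply: preimage_closed => // x _.
move=> V [B /= Bx BV]; exists (fun i j => [set y | B i j (y + s i j)]) => /=.
  move=> i j; have := Bx i j; rewrite mxE.
  have : y + s i j @[y --> x i j] --> x i j + s i j.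
    by apply: cvgD; [exact: cvg_id|exact: cvg_cst].
  by apply.
by move=> y yB; apply: BV => i j; rewrite mxE; exact: yB.
Qed.

Definition hull_action s (G : closed_subset R N) : closed_subset R N :=
  ClosedSubset (translate s G) (closed_translate (closed_subsetP (c := G))).

(* Points of the ambient space are closed sets, so this is the orbit closure of
   L only for closed L; uniformly discrete sets are closed. *)
Definition hull L : set (closed_subset R N) :=
  closure [set G : closed_subset R N | exists s, G = translate s L :> set _].

Definition uniformly_discrete L : Prop :=
  exists2 r : R, 0 < r &
    forall x y, L x -> L y -> x <> y -> r <= enorm (x - y).

Definition box (t : R) : set 'cV[R]_N :=
  [set x | forall i, x i 0 \in `[- t, t]].

(* Lebesgue measure of the box, as the product of N one-dimensional measures. *)
Definition box_volume (t : R) : R :=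
  fine (lebesgue_measure `[- t, t]%classic) ^+ N.

Definition upper_density (S : set 'cV[R]_N) : \bar R :=
  limf_esup (fun t : R => counting (S `&` box t) * ((box_volume t)^-1)%:E)%E
    (+oo)%R.

Definition embedded_fullshift (L : set 'cV[R]_N) (Xi : set (closed_subset R N))
    (S : set 'cV[R]_N) : Prop :=
  [/\ Xi `<=` hull L, closed Xi, (0 < upper_density S)%E,
      uniformly_discrete (\bigcup_(G in Xi) (G : set 'cV[R]_N)) &
      forall S', S' `<=` S -> exists2 G, Xi G & G `&` S = S'].

End Hull.
Arguments box_volume {R} N t.

(* Topological entropy of the restriction of an action phi of R^N to an
   invariant subset X of a metric space. The maximum over s in the definition of
   separation is attained for continuous actions, hence the existential. *)
Section TopologicalEntropy.
Context {R : realType} {N : nat} {T : metricType R}.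
Context (phi : 'cV[R]_N -> T -> T) (X : set T).

Definition et_separated (e t : R) (Y : set T) : Prop :=
  forall x y, Y x -> Y y -> x <> y ->
    exists2 s, box t s & e <= mdist (phi s x) (phi s y).

Definition separation_number (e t : R) : \bar R :=
  ereal_sup [set counting Y | Y in [set Y | Y `<=` X /\ et_separated e t Y]].

Definition topological_entropy : \bar R :=
  ereal_sup [set limf_esup (fun t : R =>
      ((box_volume N t)^-1)%:E * lne (separation_number e t))%E (+oo)%R
    | e in [set e : R | 0 < e]].

End TopologicalEntropy.

Section CutAndProject.
Context {R : realType} {N : nat}.
Implicit Types (A : 'M[R]_(N + 1)) (v : 'cV[int]_N).

Definition lattice A : set 'cV[R]_(N + 1) :=
  [set A *m map_mx intr z | z in [set: 'cV[int]_(N + 1)]].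

Definition cut_and_project_scheme A : Prop :=
  [/\ A \in unitmx,
      {in lattice A &, injective (@pi1 R N)} &
      dense [set pi2 x | x in lattice A]].

Definition model_set A (W : set R) : set 'cV[R]_N :=
  [set pi1 x | x in lattice A `&` (@pi2 R N) @^-1` W].

Definition lattice_point A v (w : int) : 'cV[R]_(N + 1) :=
  A *m map_mx intr (col_mx v w%:M).

(* v_{N+1}; unique because the lower right entry of A is 1. *)
Definition last_coord A v : int :=
  xget 0 [set w | 0 <= pi2 (lattice_point A v w) < 1].

Definition lpt A v : 'cV[R]_N := pi1 (lattice_point A v (last_coord A v)).

Definition lstar A v : R := pi2 (lattice_point A v (last_coord A v)).

End CutAndProject.

Definition int_supnorm (N : nat) (v : 'cV[int]_N) : nat := \max_i absz (v i 0%R).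

Definition shift_set (R : realType) (W : set R) (c : R) : set R :=
  [set w + c | w in W].

Definition boundary (T : topologicalType) (A : set T) : set T :=
  closure A `\` interior A.

Fixpoint cantor_stage {R : realType} (n : nat) : set R :=
  if n is n'.+1 then
    [set x / 3 | x in cantor_stage n'] `|`
    [set (2 + x) / 3 | x in cantor_stage n']
  else `[0, 1]%classic.

Definition cantor_ternary (R : realType) : set R :=
  \bigcap_(n in [set: nat]) cantor_stage n.
Arguments cantor_ternary : clear implicits.

(* Membership in the completion of the Borel sigma-algebra; the library's
   [measurable] on R is Borel. *)
Definition lebesgue_measurable (R : realType) (A : set R) : Prop :=
  completed_algebra_gen (@lebesgue_measure R) A.

Definition pattern_set (R : realType) (A : nat -> set R) (F : {fset nat})
    (a : nat -> bool) : set R :=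
  (\bigcap_(s in [set s | s \in F /\ a s]) A s) `\`
  (\bigcup_(s in [set s | s \in F /\ ~~ a s]) A s).

Definition locally_metrically_independent0 (R : realType) (A : nat -> set R) :
    Prop :=
  forall (F : {fset nat}) (a : nat -> bool) (e : R), 0 < e ->
    (0 < completed_lebesgue_measure (`]- e, e[%classic `&` pattern_set A F a)%R)%E.

Definition window (R : realType) (I A : nat -> set R) : set R :=
  (`[0, 1]%classic `\` \bigcup_k I k) `|`
  \bigcup_k (I k `&` shift_set (A k) (inf (I k))).

(* Main.v *)
Require Import Defs.
From mathcomp Require Import all_boot all_order all_algebra.
From mathcomp Require Import finmap.
From mathcomp Require Import all_classical all_reals all_analysis measurable_realfun.
From mathcomp Require Import ring lra zify.
Import Order.TTheory GRing.Theory Num.Theory.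
Import numFieldNormedType.Exports numFieldTopology.Exports.
Local Open Scope classical_set_scope.
Local Open Scope ring_scope.
Set Implicit Arguments.
Unset Strict Implicit.
Unset Printing Implicit Defensive.

(** Fix [u > 0] small. For [k] in a finite set, the point [lstar A (v (n k)) + u]
    lies in the gap [I k], so that it belongs to the window [W] exactly when [u]
    belongs to [As k] ([window_gap]). Hence the trace on the points
    [lpt A (v (n k))] of the model set with window [W - u] is the pattern of
    membership of [u] in the sets [As k]. Translating the model set with window
    [W + theta] by [pi1 l], where [l] is a lattice point, gives the model set
    with window [W - u] for [u = pi2 l - theta] ([translate_model_set]).

    By local metric independence, each finite pattern is shown by a set of
    positive measure of arbitrarily small [u > 0] ([borel_pattern_pos]). As the
    heights [pi2 l] are dense, the Lebesgue density theorem shows that for almost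
    every [theta] some difference [pi2 l - theta] falls into this set
    ([ae_dense_reflection]). There are countably many finite patterns, so that
    for almost every [theta] the translates of the model set show all of them.
    These translates lie in a single model set, with window [[-1, 1]], which is
    uniformly discrete ([uniformly_discrete_model_set]). Limits of its subsets
    along an ultrafilter stay in the hull and show all the infinite patterns
    ([ultralimit_closed_subset], [embedded_fullshift_patterns]).

    The set [S] has positive upper density ([upper_density_lpt]): the lattice
    points [lpt A w] grow at most linearly with [w], and the limit of [k / n k]
    being greater than 1/2, at least half of an initial piece of the numbering
    consists of vectors [v (n k)].

    Positive entropy follows from the fullshift alone ([fullshift_entropy_gt0]).
    If two members of the fullshift differ at a point [x] of [S], moving [x] to
    the origin separates them by an amount that depends only on the least
    distance between points of the uniformly discrete union of the fullshift
    ([mdist_translate_ge]). So [q] points of [S] in a box give [2 ^ q] separated elements,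
    and the entropy is at least [ln 2] times any real number below the upper
    density of [S]. *)

(** * Translates of sets of positive measure *)

Section DenseTranslates.
Context {R : realType}.
Local Notation mu := (@lebesgue_measure R).

Lemma measurable_fun_subl (g : R) :
  measurable_fun [set: measurableTypeR R]
    ((fun x => g - x) : _ -> measurableTypeR R).
Proof. exact: measurable_funB. Qed.

Lemma lebesgue_measure_subl (g : R) (B : set R) : measurable B ->
  mu ((fun x => g - x) @^-1` B) = mu B.
Proof.
move=> mB; symmetry.
pose T : measurableTypeR R -> measurableTypeR R := fun x => g - x.
have mT : measurable_fun setT T by exact: measurable_fun_subl.
pose HT : {mfun measurableTypeR R >-> measurableTypeR R} :=
  mfun_Sub (mem_set mT).
(* Lebesgue measure is the only measure giving intervals their length. *)
apply: (@lebesgue_measure_unique R (pushforward mu HT)) => //.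
move=> _ [[a b] /= ab <-]; rewrite /pushforward.
rewrite (_ : _ @^-1` _ = `[g - b, g - a[%classic).
  rewrite !lebesgue_measure_itv/= !lte_fin ltrD2l ltrN2; case: ifP => // _.
  by rewrite -!EFinB; congr EFin; ring.
apply/seteqP; split => x /=; rewrite !in_itv/= /T; lra.
Qed.

Lemma density_point (B : set R) (k : R) : measurable B -> (0 < mu B)%E -> k < 1 ->
  exists x, \forall r \near 0^'+, ((k * (r *+ 2))%:E < mu (B `&` ball x r))%E.
Proof.
move=> mB B0 k1.
have [x [Bx xl]] : exists x, B x /\ (mu (B `&` ball x r) * (mu (ball x r))^-1
                      @[r --> 0^'+] --> (\1_B x)%:E)%E.
  apply: contrapT => nex; move: B0; rewrite lt0e => /andP[/eqP + _]; apply.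
  apply/(negligibleP mu); first exact: mB.
  apply: negligibleS (lebesgue_density mB) => x Bx /= xl.
  by apply: nex; exists x.
exists x.
have : nbhs (\1_B x)%:E [set y | (k%:E < y)%E].
  by apply: (@nbhs_open_ereal_gt _ _ (fun=> k)); rewrite indicE mem_set.
move=> /xl; rewrite /nbhs/= => near_k.
near=> r.
have r0 : 0 < r by [].
have : (k%:E < mu (B `&` ball x r) * (mu (ball x r))^-1)%E by near: r.
rewrite (lebesgue_measure_ball _ (ltW r0)) inver mulrn_eq0/= gt_eqF//.
by rewrite lte_pdivlMr ?pmulrn_lgt0// -EFinM.
Unshelve. all: by end_near. Qed.

(** By the density theorem, two sets of positive measure fill most of two
    intervals of equal length; a suitable element of a dense set matches these
    intervals almost exactly, leaving no room for the sets to be disjoint. *)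
Lemma dense_reflection_meets (G B F : set R) : dense G ->
  measurable B -> measurable F -> (0 < mu B)%E -> (0 < mu F)%E ->
  exists g x, [/\ G g, F x & B (g - x)].
Proof.
move=> dG mB mF B0 F0.
(* Twice 3/4 of the length 2 r exceeds the length 2 (11/10) r of an interval
   that contains both of the matched intervals. *)
have k1 : 3 / 4 < 1 :> R by lra.
have [x nx] := density_point mB B0 k1.
have [y ny] := density_point mF F0 k1.
have [r [r0 Br Fr]] : exists r, [/\ 0 < r,
    ((3 / 4 * (r *+ 2))%:E < mu (B `&` ball x r))%E &
    ((3 / 4 * (r *+ 2))%:E < mu (F `&` ball y r))%E].
  near (0:R)^'+ => r; exists r; split => //; by near: r.
have [g [/= gb Gg]] : (ball (x + y) (r / 10) `&` G) !=set0.
  apply: dG; last exact: ball_open.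
  by exists (x + y); apply: ballxx; lra.
exists g; apply: contrapT => nex.
pose B' := (fun z => g - z) @^-1` (B `&` ball x r).
pose F' := F `&` ball y r.
have mB' : measurable (B `&` ball x r).
  by apply: measurableI => //; exact: measurable_ball.
have mB'' : measurable (B' : set (measurableTypeR R)).
  by rewrite -[B']setTI; exact: measurable_fun_subl.
have mF' : measurable F'.
  by apply: measurableI => //; exact: measurable_ball.
have eB : mu B' = mu (B `&` ball x r) by exact: lebesgue_measure_subl.
have BF : B' `&` F' = set0.
  rewrite -subset0 => z [[Bz _] [Fz _]]; apply: nex; by exists z.
have sub : B' `|` F' `<=` ball y (11 / 10 * r).
  move: gb; rewrite /ball/= ltr_norml => gb z [[_]|[_]]; rewrite /ball/= !ltr_norml; lra.
have BF_le : (mu (B' `|` F') <= mu (ball y (11 / 10 * r)))%E.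
  apply: le_measure => //; rewrite inE; first exact: measurableU.
  exact: measurable_ball.
have BF_eq : mu (B' `|` F') = (mu B' + mu F')%E.
  by apply: measureU.
move: BF_le; rewrite BF_eq eB (lebesgue_measure_ball _ _); last by lra.
apply/negP; rewrite -ltNge (lt_trans _ (lteD Br Fr))// -EFinD lte_fin; lra.
Unshelve. all: by end_near. Qed.

(** The exceptional set would otherwise be a set of positive measure that all
    the reflected copies miss. Countability makes it measurable. *)
Lemma ae_dense_reflection (T : countType) (g : T -> R) (B : set R) :
  dense (range g) -> measurable B -> (0 < mu B)%E ->
  {ae mu, forall x, exists t, B (g t - x)}.
Proof.
move=> dG mB B0.
pose Fn n := if @choice.unpickle T n is Some t then (fun x => g t - x) @^-1` (~` B)
             else setT.
have mF : measurable (\bigcap_n Fn n : set (measurableTypeR R)).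
  apply: bigcapT_measurable => n; rewrite /Fn; case: choice.unpickle => [t|] //.
  rewrite -[X in measurable X]setTI.
  by apply: measurable_fun_subl => //; exact: measurableC.
have nF : mu.-negligible (\bigcap_n Fn n).
  apply/(negligibleP mu); first exact: mF.
  apply/eqP; rewrite eq_le measure_ge0 andbT leNgt; apply/negP => F0.
  have [_ [x [[t _ <-] Fx Bx]]] := dense_reflection_meets dG mB mF B0 F0.
  by have := Fx (choice.pickle t) I; rewrite /Fn choice.pickleK.
apply: negligibleS nF => x /= nx n _; rewrite /Fn.
by case: choice.unpickle => [t|//] /= Bx; apply: nx; exists t.
Qed.

End DenseTranslates.

Section CompletedMeasure.
Context {R : realType}.
Local Notation mu := (@lebesgue_measure R).

Lemma borel_subset_pos (E : set R) : lebesgue_measurable E ->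
  (0 < completed_lebesgue_measure E)%E ->
  exists B, [/\ B `<=` E, measurable B & (0 < mu B)%E].
Proof.
move=> [B mB [M [M' [mM' M'0 MM']] <-]] E0; exists B; split => //.
suff : (completed_lebesgue_measure (B `|` M) <= mu B)%E by apply: lt_le_trans.
have : (completed_lebesgue_measure (B `|` M) <=
    completed_lebesgue_measure B + completed_lebesgue_measure M)%E.
  by apply: outer_measureU2.
move=> /le_trans; apply.
rewrite -[leRHS]adde0; apply: leeD; first exact: lexx.
by rewrite -M'0; apply: le_outer_measure.
Qed.

Lemma lebesgue_measurable_pattern (As : nat -> set R) F a :
  (forall k, lebesgue_measurable (As k)) ->
  lebesgue_measurable (pattern_set As F a).
Proof.
rewrite /lebesgue_measurable -g_sigma_completed_algebra_genE => mAs.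
apply: measurableD; first by apply: bigcap_measurableType => k _; exact: mAs.
by apply: bigcup_measurable => k _; exact: mAs.
Qed.

(** Prescribing [false] everywhere would put negative reals in the pattern set.
    Prescribing [true] at one more index removes them, since the sets [As k]
    lie in the unit interval; the point 0 itself is a null set. *)
Lemma borel_pattern_pos (As : nat -> set R) (b : nat -> bool) (m : nat) (e : R) :
  (forall k, lebesgue_measurable (As k)) ->
  (forall k, As k `<=` `[0, 1]) ->
  locally_metrically_independent0 As -> 0 < e ->
  exists B, [/\ measurable B, (0 < mu B)%E & forall u, B u ->
    0 < u < e /\ forall k, (k < m)%N -> (As k u <-> b k)].
Proof.
move=> mAs sAs iAs e0.
pose F : {fset nat} := [fset k in iota 0 m.+1]%fset.
pose a k := (k == m) || b k.
have [||B [BE mB B0]] := @borel_subset_pos (`]- e, e[%classic `&` pattern_set As F a).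
- have := lebesgue_measurable_pattern F a mAs.
  rewrite /lebesgue_measurable -g_sigma_completed_algebra_genE => mP.
  apply: measurableI => //; rewrite g_sigma_completed_algebra_genE.
  exists `]- e, e[%classic => //; exists set0; [exact: negligible_set0|exact: setU0].
- exact: iAs.
exists (B `\` [set (0:R)%R]); split.
- exact: measurableD.
- rewrite lt0e measure_ge0 andbT; apply/eqP => B00.
  have : (mu B <= mu (B `\` [set (0:R)%R]) + mu [set (0:R)%R])%E.
    rewrite -[X in (mu X <= _)%E](setUIDK B [set (0:R)%R]) setUC.
    apply: le_trans (measureU2 _ _ _) _; [exact: measurableD|exact: measurableI|].
    by apply: leeD => //; apply: le_measure; rewrite ?inE//; exact: measurableI.
  by rewrite B00 lebesgue_measure_set1 adde0 leNgt B0.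
move=> u [/BE[/= ue [uT uF]] /eqP u0].
have Am : As m u by apply: uT; rewrite /= /a eqxx; split => //; rewrite !inE mem_iota; lia.
have := sAs _ _ Am; move: ue; rewrite /= !in_itv/= => /andP[_ ->] /andP[u0' _].
split; first by rewrite andbT lt_def u0.
move=> k km.
have kF : k \in F by rewrite !inE mem_iota; lia.
have ak : a k = b k by rewrite /a (_ : (k == m) = false)//; lia.
split => [Aku|bk]; last by apply: uT; rewrite /= ak.
by apply/negPn/negP => nbk; apply: uF; exists k => //=; rewrite ak.
Qed.

End CompletedMeasure.

(** * The space of closed sets *)

Section ChabautyFell.
Context {R : realType} {N : nat}.
Implicit Types (G L : closed_subset R N) (D : set 'cV[R]_N).

Lemma nbhs_enorm_lt (x : 'cV[R]_N) (e : R) : 0 < e ->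
  nbhs x [set y | enorm (x - y) < e].
Proof.
move=> e0; apply/nbhs_ballP; exists (e / N.+1%:R); rewrite /=; first exact: divr_gt0.
move=> y xy; rewrite /= -(ltr_pXn2r (ltn0Sn 1)) ?nnegrE ?enorm_ge0 ?ltW// sqr_enorm.
have d0 : 0 < (e / N.+1%:R) ^+ 2 by rewrite exprn_gt0// divr_gt0.
apply: (@le_lt_trans _ _ (\sum_(i < N) (e / N.+1%:R) ^+ 2)).
  apply: ler_sum => i _; rewrite -[leLHS]real_normK ?num_real//.
  rewrite ler_pXn2r ?nnegrE// ?divr_ge0 ?ltW//.
  by move: xy; rewrite /ball/= => -[_ /(_ i 0)]; rewrite /ball/= !mxE.
rewrite sumr_const card_ord -[X in X < _]mulr_natl.
have -> : e ^+ 2 = N.+1%:R ^+ 2 * (e / N.+1%:R) ^+ 2.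
  by rewrite -exprMn mulrC divfK// pnatr_eq0.
rewrite ltr_pM2r// -natrX ltr_nat; lia.
Qed.

Lemma uniformly_discreteS D D' :
  D `<=` D' -> uniformly_discrete D' -> uniformly_discrete D.
Proof.
by move=> DD' [r r0 Dr]; exists r => // x y Dx Dy; apply: Dr; exact: DD'.
Qed.

Lemma closed_uniformly_discrete D : uniformly_discrete D -> closed D.
Proof.
move=> [r r0 Dr] x cDx.
have r20 : 0 < r / 2 by rewrite divr_gt0.
have [y [Dy /= xy]] := cDx _ (nbhs_enorm_lt x r20).
have [->//|xNy] := pselect (x = y).
have d0 : 0 < enorm (x - y).
  rewrite lt_def enorm_ge0 andbT; apply/eqP => /enorm_eq0 /subr0_eq; exact: xNy.
have [z [Dz /= xz]] := cDx _ (nbhs_enorm_lt x d0).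
have yNz : y <> z by move=> yz; rewrite yz ltxx in xz.
have := Dr _ _ Dy Dz yNz; have := ler_enormB y x z; rewrite (enormBC y x); lra.
Qed.

Let north : 'cV[R]_(N + 1) := col_mx 0 1%:M.

Let enorm_north (p : 'cV[R]_(N + 1)) : enorm p = 1 ->
  enorm (p - north) ^+ 2 = 2 * (1 - pi2 p).
Proof.
move=> p1; rewrite sqr_enorm.
have : enorm p ^+ 2 = 1 by rewrite p1 expr1n.
rewrite sqr_enorm !big_split_ord/= !big_ord1 /pi2 [X in 2 * (1 - X)]mxE.
have -> : (p - north) (rshift N ord0) 0 = p (rshift N 0) 0 - 1.
  by rewrite mxE [X in _ + X]mxE /north col_mxEd mxE eqxx.
under [X in _ -> X + _ = _]eq_bigr do
  rewrite mxE [X in _ + X]mxE /north col_mxEu mxE subr0.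
by move=> /(canRL (addrK _)) ->; ring.
Qed.

(** A point [p] of the sphere at distance more than [e] from the north pole
    satisfies [1 - pi2 p > e ^+ 2 / 2], so that its stereographic projection
    has coordinates of size less than [2 / e ^+ 2]. All other points are
    approximated by the pole, which lies in every lifted set. *)
Let dist_to_lift_agree L1 L2 (e : R) p : 0 < e ->
  L1 `&` box (2 / e ^+ 2) `<=` L2 ->
  sphere_lift L1 p -> dist_to p (sphere_lift L2) <= e.
Proof.
move=> e0 L12 [p1 pL].
case: (leP (enorm (p - north)) e) => [pe|ep].
  apply: le_trans pe; apply: dist_to_le; rewrite /north; split.
    rewrite /sphere/= /enorm big_split_ord/= big1 ?add0r; last first.
      by move=> i _; rewrite col_mxEu mxE expr0n.
    by rewrite big_ord1 col_mxEd mxE eqxx expr1n sqrtr1.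
  by right; rewrite /= /stereo /pi2 col_mxKd mxE !eqxx.
suff L2p : sphere_lift L2 p by rewrite (dist_to_mem L2p) ltW.
split => //; case: pL => [[x L1x xp]|]; last by right.
left; exists x => //; apply: L12; split => // i.
have e20 : 0 < e ^+ 2 by rewrite exprn_gt0.
have h : e ^+ 2 < 2 * (1 - pi2 p).
  by rewrite -(enorm_north p1) ltr_pXn2r ?nnegrE ?enorm_ge0 ?ltW.
move: xp; rewrite /stereo; case: eqP => // _ [->].
rewrite in_itv/= -ler_norml mxE normrM normfV (@ger0_norm _ (1 - _)); last by lra.
rewrite ler_pdivrMl; last by lra.
have p1i : `|pi1 p i 0| <= 1.
  by rewrite -p1 /pi1 mxE; exact: coord_le_enorm.
apply: (le_trans p1i).
rewrite mulrA ler_pdivlMr//; lra.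
Qed.

Lemma closed_subset_dist_agree L1 L2 (e : R) : 0 < e ->
  L1 `&` box (2 / e ^+ 2) = L2 `&` box (2 / e ^+ 2) -> mdist L1 L2 <= e.
Proof.
move=> e0 L12; rewrite /mdist/= /closed_subset_dist /hausdorff_dist ge_max.
apply/andP; split; apply: ge_sup.
- have [p Lp] := sphere_lift_neq0 L1; by exists (dist_to p (sphere_lift L2)), p.
- by move=> _ [p Lp <-]; apply: dist_to_lift_agree Lp => //; rewrite L12; exact: subIsetl.
- have [p Lp] := sphere_lift_neq0 L2; by exists (dist_to p (sphere_lift L1)), p.
- by move=> _ [p Lp <-]; apply: dist_to_lift_agree Lp => //; rewrite -L12; exact: subIsetl.
Qed.

(** Stereographic projection is continuous at a lift of [x], so that closeness on
    the sphere gives closeness near [x], at a scale that depends on [x]. *)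
Lemma closed_subset_dist_near (x : 'cV[R]_N) (V : set 'cV[R]_N) : nbhs x V ->
  exists2 e, 0 < e & forall L1 L2, (L1 : set _) x -> mdist L1 L2 < e ->
    exists2 y, V y & (L2 : set _) y.
Proof.
move=> xV; have [p [p1 _ px]] := stereo_surj x.
have [e e0 eV] := stereo_continuous px xV.
exists e => // L1 L2 L1x d12.
have L1p : sphere_lift L1 p by split => //=; left; exists x.
have [z0 L2z0] := sphere_lift_neq0 L2.
have h : dist_to p (sphere_lift L2) < e.
  apply: le_lt_trans d12; rewrite /mdist/= /closed_subset_dist /hausdorff_dist le_max.
  apply/orP; left; apply: ub_le_sup; last by exists p.
  exists 2 => _ [z [z1 _] <-]; rewrite (le_trans (dist_to_le z L2z0))//.
  rewrite (le_trans (ler_enormD _ _))// enormN z1.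
  by case: L2z0 => -> _; lra.
have [|_ [q [_ L2q] <-] pq] := inf_lt _ h.
  by exists (enorm (p - z0)), z0.
have [y qy Vy] := eV _ pq.
by move: L2q => [[z L2z]|] /=; rewrite qy// => -[zy]; exists y => //; rewrite -zy.
Qed.

Lemma closed_sub_closed_subsets D : closed D ->
  closed [set L : closed_subset R N | (L : set _) `<=` D].
Proof.
move=> cD L cL x Lx; apply: cD => V xV.
have [e e0 eV] := closed_subset_dist_near xV.
have [L' [L'D LL']] := cL _ (nbhsx_ballx L e e0).
have [y Vy L'y] : exists2 y, V y & (L' : set _) y.
  by apply: eV Lx _; move: LL'; rewrite ballEmdist.
by exists y; split => //; exact: L'D.
Qed.

End ChabautyFell.

Section UltrafilterLimit.
Context {R : realType} {N : nat}.

(** A form of compactness of the space of closed sets. An ultrafilter decides for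
    each point of [D] whether it belongs to the limit; a box contains only
    finitely many points of [D], so that some members of the sequence agree with
    the limit on the whole box and are close to it. *)
Lemma ultralimit_closed_subset (D : set 'cV[R]_N)
    (O : set (closed_subset R N)) (G : nat -> closed_subset R N) :
  (forall D', D' `<=` D -> closed D') -> (forall t, finite_set (D `&` box t)) ->
  (forall n, O (G n)) -> (forall n, (G n : set _) `<=` D) ->
  exists L : closed_subset R N, [/\ closure O L, (L : set _) `<=` D &
    forall x b, (\forall n \near \oo, (G n : set _) x <-> b) -> (L : set _) x <-> b].
Proof.
move=> cD fD OG GD.
have [U [UU FU]] := @ultraFilterLemma nat \oo _.
pose K := [set x | D x /\ U [set n | (G n : set _) x]].
have KD : K `<=` D by move=> x [].
exists (ClosedSubset K (cD _ KD)); split => //.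
- move=> V /nbhs_ballP[e /= e0 eV].
  have e20 : 0 < e / 2 by rewrite divr_gt0.
  pose t := 2 / (e / 2) ^+ 2.
  have UK x : U [set n | (G n : set _) x <-> K x].
    have [Ux|] := in_ultra_setVsetC [set n | (G n : set _) x] UU.
      by apply: filterS (Ux) => n /= Gx; split => // _; split => //; exact: (GD n x).
    move=> Ux; apply: filterS (Ux) => n /= nGx; split => // -[_ Ux'].
    by have [m [? ?]] := filter_ex (filterI Ux Ux').
  have : U [set n | forall x, (D `&` box t) x -> ((G n : set _) x <-> K x)].
    have /finite_fsetP[X ->] := fD t.
    have : U (\bigcap_(x in [set` X]) [set n | (G n : set _) x <-> K x]).
      by apply: filter_bigI => x _; exact: UK.
    by apply: filterS => n nX x Xx; exact: nX x Xx.
  move=> /filter_ex[n nP]; exists (G n); split => //.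
  apply: eV; rewrite ballEmdist/=; apply: le_lt_trans (_ : e / 2 < e); last by lra.
  apply: closed_subset_dist_agree => //; apply/seteqP; split => x [Lx bx]; split => //.
    by apply/(nP x) => //; split => //; exact: (KD x).
  by apply/(nP x) => //; split => //; exact: (GD n x).
- move=> x b bP.
  have Ub : U [set n | (G n : set _) x <-> b] by apply: FU.
  split => [[Dx Ux]|xb].
    by have [n [/= [Gb _] Gx]] := filter_ex (filterI Ub Ux); apply: Gb.
  split; last by apply: filterS Ub => n /= [_ bG]; apply: bG.
  by have [n [_ bG]] := filter_ex Ub; apply: (GD n x); apply: bG.
Qed.

End UltrafilterLimit.

(** * Lattices and model sets *)

Section Lattice.
Context {R : realType}.

Lemma mulmx_coord_bound m k (M : 'M[R]_(m, k)) :
  exists2 C : R, 0 < C & forall z t, 0 <= t -> box t z -> box (C * t) (M *m z).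
Proof.
exists (1 + \sum_i \sum_j `|M i j|).
  by rewrite ltr_wpDr// sumr_ge0// => i _; rewrite sumr_ge0.
move=> z t t0 zt i; rewrite in_itv/= -ler_norml mxE.
have zt' j : `|z j 0| <= t by have := zt j; rewrite in_itv/= ler_norml.
apply: (@le_trans _ _ (\sum_j `|M i j| * t)).
  apply: (le_trans (ler_norm_sum _ _ _)); apply: ler_sum => j _.
  by rewrite normrM ler_wpM2l.
rewrite -mulr_suml ler_wpM2r// (bigD1 i)//= addrCA lerDl addr_ge0//.
by rewrite sumr_ge0// => ? _; rewrite sumr_ge0.
Qed.

Definition cube_vec m k (f : {ffun 'I_m -> 'I_(k.*2.+1)}) : 'cV[int]_m :=
  \col_i (Posz (f i) - Posz k).

Lemma cube_vec_inj m k : injective (@cube_vec m k).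
Proof.
move=> f g /colP fg; apply/ffunP => i; have := fg i; rewrite !mxE => /addIr[].
exact: val_inj.
Qed.

Lemma cube_vecP m k (z : 'cV[int]_m) : (int_supnorm z <= k)%N <->
  exists f, z = @cube_vec m k f.
Proof.
rewrite /int_supnorm; split => [/bigmax_leqP zk|[f ->]].
  exists [ffun i => inord (absz (z i 0 + Posz k))]; apply/colP => i.
  rewrite mxE ffunE inordK; have := zk i isT; lia.
apply/bigmax_leqP => i _; rewrite mxE; have := ltn_ord (f i); lia.
Qed.

Lemma finite_lattice_box (N : nat) (A : 'M[R]_(N + 1)) (t : R) : A \in unitmx -> 0 <= t ->
  finite_set (lattice A `&` box t).
Proof.
move=> uA t0; have [C C0 CA] := mulmx_coord_bound (invmx A).
pose k := (Num.truncn (C * t)).+1.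
apply: (@sub_finite_set _ _ [set A *m map_mx intr (@cube_vec _ k f) | f in setT]).
  move=> _ [[z _ <-] /(CA _ _ t0)]; rewrite mulKmx// => zt.
  have [f zf] : exists f, z = @cube_vec _ k f; last by exists f => //; rewrite -zf.
  apply/cube_vecP/bigmax_leqP => i _; have := zt i.
  rewrite mxE in_itv/= -ler_norml -intr_norm => zi.
  have : `|z i 0|%:~R < k%:R :> R by apply: (le_lt_trans zi); exact: truncnS_gt.
  by rewrite pmulrn ltr_int; lia.
by apply: finite_image; exact: finite_finset.
Qed.

Context {N : nat} (A : 'M[R]_(N + 1)).

Lemma latticeB x y : lattice A x -> lattice A y -> lattice A (x - y).
Proof.
move=> [z _ <-] [w _ <-]; exists (z - w) => //.
by rewrite -mulmxBr; congr (_ *m _); apply/matrixP => i j; rewrite !mxE rmorphB.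
Qed.

Lemma lattice0 : lattice A 0.
Proof. by exists 0 => //; rewrite map_mx0 mulmx0. Qed.

Lemma pi1B (x y : 'cV[R]_(N + 1)) : pi1 (x - y) = pi1 x - pi1 y.
Proof. by apply/matrixP => i j; rewrite !mxE. Qed.

Lemma pi2B (x y : 'cV[R]_(N + 1)) : pi2 (x - y) = pi2 x - pi2 y.
Proof. by rewrite /pi2 !mxE. Qed.

Lemma box_pi (x : 'cV[R]_(N + 1)) t : box t (pi1 x) -> `|pi2 x| <= t -> box t x.
Proof.
move=> x1; rewrite /pi2 mxE ler_norml => x2 i.
rewrite -(splitK i); case: (fintype.split i) => j /=.
  by have := x1 j; rewrite mxE.
by rewrite (ord1 j) in_itv.
Qed.

Lemma model_setS (W W' : set R) : W `<=` W' -> model_set A W `<=` model_set A W'.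
Proof. by move=> WW' _ [x [xL xW] <-]; exists x => //; split => //; exact: WW'. Qed.

Lemma translate_model_set (W : set R) l : lattice A l ->
  translate (pi1 l) (model_set A W) = model_set A (shift_set W (- pi2 l)).
Proof.
move=> lA; apply/seteqP; split => [_ [_ [x [xA xW] <-] <-]|_ [x [xA [w Ww wx]] <-]].
  exists (x - l); last exact: pi1B.
  by split; [exact: latticeB|exists (pi2 x) => //; rewrite pi2B].
have lx : lattice A (x + l).
  rewrite -[l]opprK; apply: latticeB => //; rewrite -sub0r.
  exact: latticeB lattice0 lA.
exists (pi1 (x + l)); last by rewrite -pi1B addrK.
exists (x + l) => //; split => //=.
suff -> : pi2 (x + l) = w by [].
by rewrite -(subrK (pi2 l) w) wx /pi2 !mxE.
Qed.

Lemma finite_min (T : choiceType) (X : set T) (f : T -> R) : finite_set X ->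
  (forall x, X x -> 0 < f x) -> exists2 r, 0 < r & forall x, X x -> r <= f x.
Proof.
move=> /finite_fsetP[Y ->] Y0; exists (\big[Num.min/1]_(y <- Y) f y).
  rewrite big_seq; apply: (big_ind (fun r => 0 < r)) => //.
  by move=> a b a0 b0; rewrite lt_min a0 b0.
by move=> x xY; exact: ge_bigmin_seq.
Qed.

Context (hA : cut_and_project_scheme A).

Lemma finite_model_set_box (W : set R) (c t : R) : 0 <= c -> W `<=` `[- c, c] ->
  finite_set (model_set A W `&` box t).
Proof.
move=> c0 Wc; have [uA _ _] := hA.
apply: (@sub_finite_set _ _ [set pi1 x | x in lattice A `&` box (Num.max c t)]).
  move=> _ [[x [xA /Wc xW] <-] xt]; exists x => //; split => //.
  apply: box_pi.
    move=> i; have := xt i; rewrite !in_itv/= -!ler_norml => /le_trans; apply.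
    by rewrite le_max lexx orbT.
  by move: xW; rewrite /= in_itv/= -ler_norml => /le_trans; apply; rewrite le_max lexx.
by apply: finite_image; apply: finite_lattice_box; rewrite ?le_max ?c0.
Qed.

(** Differences of points of a model set are projections of lattice points of
    bounded height. Only finitely many of these are close to the origin, and
    none but the origin projects to it. *)
Lemma uniformly_discrete_model_set (W : set R) (c : R) : W `<=` `[- c, c] ->
  uniformly_discrete (model_set A W).
Proof.
move=> Wc; have [uA iA _] := hA.
pose c' := Num.max (c *+ 2) 1.
have c'0 : 0 <= c' by rewrite le_max ler01 orbT.
have [|r r0 rX] := @finite_min _
  ((lattice A `&` box c') `\ (0 : 'cV[R]_(N + 1))) (fun x => enorm (pi1 x))
  (finite_setD _ (finite_lattice_box uA c'0)).
  move=> x [[xA _] /= x0]; rewrite lt_def enorm_ge0 andbT; apply/eqP => /enorm_eq0 x1.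
  apply: x0; apply: iA; rewrite ?inE//; first exact: lattice0.
  by rewrite x1; apply/matrixP => i j; rewrite !mxE.
exists (Num.min r 1); first by rewrite lt_min r0 ltr01.
move=> _ _ [x [xA /Wc xW] <-] [y [yA /Wc yW] <-] xy.
rewrite ge_min orbC; case: leP => //= xy1; rewrite -pi1B.
apply: rX; split; last first.
  by move=> /= /subr0_eq xy'; apply: xy; rewrite xy'.
split; first exact: latticeB.
apply: box_pi => [i|].
  rewrite in_itv/= -ler_norml (le_trans (coord_le_enorm _ _))// pi1B.
  by rewrite (le_trans (ltW xy1))// le_max lexx orbT.
rewrite le_max pi2B ler_norml; move: xW yW; rewrite /= !in_itv/= => xW yW.
by apply/orP; left; lra.
Qed.

End Lattice.

(** * Density of the chosen lattice points *)

Section Counting.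
Context {R : realType}.
Local Open Scope ereal_scope.

Lemma counting_ge (T : choiceType) (X : {fset T}) (B : set T) :
  [set` X] `<=` B -> (#|` X|%fset%:R)%:E <= counting B :> \bar R.
Proof.
move=> XB; rewrite /counting; case: asboolP => [fB|_]; last by rewrite leey.
rewrite lee_fin ler_nat; apply: fsubset_leq_card; apply/fsubsetP => x xX.
by rewrite in_fset_set// inE; exact: XB.
Qed.

Lemma counting_gt_fset (T : choiceType) (B : set T) (r : R) :
  r%:E < counting B -> exists2 X : {fset T}, [set` X] `<=` B & (r < #|` X|%fset%:R)%R.
Proof.
rewrite /counting; case: asboolP => [/finite_fsetP[X ->]|iB _].
  by rewrite set_fsetK lte_fin; exists X.
have [X XB rX] := infinite_set_fset (Num.truncn r).+1 iB.
exists X => //; apply: lt_le_trans (truncnS_gt r) _.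
by rewrite ler_nat.
Qed.

Lemma limf_esup_pinfty_ge (f : R -> \bar R) (c : \bar R) :
  (forall T, exists2 t, (T < t)%R & c <= f t) -> c <= limf_esup f (+oo)%R.
Proof.
move=> fc; apply: le_ereal_inf_tmp => _ [V [T [_ TV]] <-].
have [t Tt ct] := fc T; apply: (le_trans ct); apply: ereal_sup_ubound.
by exists t => //; exact: TV.
Qed.

Lemma limf_esup_pinfty_gt (f : R -> \bar R) (c : \bar R) :
  c < limf_esup f (+oo)%R -> forall T, exists2 t, (T < t)%R & c < f t.
Proof.
move=> cf T; have : c < ereal_sup (f @` [set t | (T < t)%R]).
  apply: lt_le_trans cf _; apply: ereal_inf_lbound.
  by exists [set t | (T < t)%R] => //; exists T; split => //; exact: num_real.
by move=> /ereal_sup_gt[_ [t Tt <-] ct]; exists t.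
Qed.

End Counting.

Section LatticePoints.
Context {R : realType} {N : nat} (A : 'M[R]_(N + 1)).
Hypothesis A_corner : A (rshift N 0) (rshift N 0) = 1.

Lemma pi2_lattice_point v w :
  pi2 (lattice_point A v w) = pi2 (lattice_point A v 0) + w%:~R.
Proof.
rewrite /pi2 /lattice_point !mxE !big_split_ord/= !big_ord1 !map_col_mx !col_mxEd.
rewrite !mxE eqxx !mulr1n mulr0 addr0 A_corner mul1r; congr (_ + _).
by apply: eq_bigr => i _; rewrite !col_mxEu.
Qed.

Lemma lstar_ge0_lt1 v : 0 <= lstar A v < 1.
Proof.
rewrite /lstar /last_coord; case: xgetP => [w -> //|].
set y := pi2 (lattice_point A v 0) => /(_ (- Num.floor y))[].
rewrite /= pi2_lattice_point rmorphN/= subr_ge0 floor_le ltrBlDl.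
by have := floorD1_gt y; rewrite rmorphD.
Qed.

Lemma lattice_lattice_point v w : lattice A (lattice_point A v w).
Proof. by exists (col_mx v w%:M). Qed.

(** The last coordinate of the lattice point is bounded by the others, because
    its height lies in the unit interval. *)
Lemma lpt_growth : exists2 K : R, 0 < K & forall v m, (int_supnorm v <= m)%N ->
  box (K * m.+1%:R) (lpt A v).
Proof.
have [C C0 CA] := mulmx_coord_bound A.
exists (C * (C + 1)) => [|v m vm]; first by rewrite mulr_gt0// addr_gt0.
set w := last_coord A v; set t : R := m.+1%:R.
have t1 : 1 <= t by rewrite ler1n.
have t0 : 0 <= t by rewrite (le_trans ler01).
have vt i : `|(v i 0)%:~R| <= t.
  rewrite -intr_norm /t pmulrn ler_int.
  by move: vm => /bigmax_leqP/(_ i isT); lia.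
have box_col (z : int) (r : R) : t <= r -> `|z%:~R| <= r ->
    box r (map_mx intr (col_mx v z%:M) : 'cV[R]_(N + 1)).
  move=> tr zr; apply: box_pi => [i|].
    by rewrite /pi1 map_col_mx col_mxKu mxE in_itv/= -ler_norml (le_trans (vt i)).
  by rewrite /pi2 map_col_mx col_mxKd !mxE eqxx mulr1n.
have y0 : `|pi2 (lattice_point A v 0)| <= C * t.
  have bv : box t (map_mx intr (col_mx v 0%:M) : 'cV[R]_(N + 1)).
    by apply: box_col => //; rewrite normr0.
  by rewrite /pi2 mxE ler_norml; have := CA _ _ t0 bv (rshift N 0); rewrite in_itv.
have wt : `|w%:~R| <= (C + 1) * t.
  have := lstar_ge0_lt1 v; rewrite /lstar -/w pi2_lattice_point.
  move: y0; rewrite !ler_norml; lra.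
have Ct : t <= (C + 1) * t by rewrite ler_peMl//; lra.
have Ct0 : 0 <= (C + 1) * t by rewrite (le_trans t0).
move=> i; rewrite /lpt /pi1 mxE -mulrA.
exact: CA _ _ Ct0 (box_col _ _ Ct wt) (lshift 1 i).
Qed.

Hypothesis uA : A \in unitmx.
Hypothesis pi1_inj : {in lattice A &, injective (@pi1 R N)}.

Lemma lpt_inj : injective (lpt A).
Proof.
move=> v w vw.
have : lattice_point A v (last_coord A v) = lattice_point A w (last_coord A w).
  by apply: pi1_inj => //; rewrite inE; exact: lattice_lattice_point.
move=> /(can_inj (mulKmx uA)) /matrixP zvw; apply/colP => i.
have := zvw (lshift 1 i) 0; rewrite mxE [RHS]mxE => /intr_inj.
by rewrite !col_mxEu.
Qed.

End LatticePoints.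

Section Density.
Context {R : realType} {N : nat}.

Lemma box_volumeE (t : R) : 0 < t -> box_volume N t = (t *+ 2) ^+ N.
Proof.
move=> t0; rewrite /box_volume lebesgue_measure_itv/= lte_fin.
by rewrite (_ : - t < t)/=; [congr (_ ^+ _); rewrite opprK mulr2n|lra].
Qed.

(** All the [(2 m + 1) ^ N] vectors of norm at most [m] precede any vector of
    larger norm. *)
Lemma numbering_norm_le (v : nat -> 'cV[int]_N) m i : bijective v ->
  (forall i j, (i <= j)%N -> (int_supnorm (v i) <= int_supnorm (v j))%N) ->
  (i < m.*2.+1 ^ N)%N -> (int_supnorm (v i) <= m)%N.
Proof.
move=> [u vK uK] v_mono; apply: contraTT; rewrite -!ltnNge => vi.
have ui f : (u (@cube_vec N m f) < i)%N.
  rewrite ltnNge; apply/negP => /v_mono; rewrite uK.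
  have /cube_vecP : exists g, cube_vec f = @cube_vec N m g by exists f.
  lia.
pose h f : 'I_i := Ordinal (ui f).
have : injective h.
  by move=> f g [] /(can_inj uK)/cube_vec_inj.
by move=> /leq_card; rewrite card_ffun !card_ord ltnS.
Qed.

Lemma upper_density_lpt (A : 'M[R]_(N + 1)) (v : nat -> 'cV[int]_N)
    (n : nat -> nat) (k0 : nat) : (1 <= N)%N ->
  A \in unitmx -> {in lattice A &, injective (@pi1 R N)} ->
  A (rshift N 0) (rshift N 0) = 1 -> bijective v ->
  (forall i j, (i <= j)%N -> (int_supnorm (v i) <= int_supnorm (v j))%N) ->
  (forall i j, (i < j)%N -> (n i < n j)%N) ->
  (forall k, (k0 <= k)%N -> (n k <= k.*2)%N) ->
  (0 < upper_density [set lpt A (v (n k)) | k in [set: nat]])%E.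
Proof.
move=> N1 uA iA A1 v_bij v_mono n_mono n_k0.
have [K K0 KA] := lpt_growth A1.
pose c : R := (2 * (K *+ 2) ^+ N)^-1.
have c0 : 0 < c by rewrite invr_gt0 mulr_gt0// exprn_gt0// pmulrn_lgt0.
apply: (@lt_le_trans _ _ c%:E) => //.
apply: limf_esup_pinfty_ge => T.
(* The first [M] vectors of the numbering have norm at most [m], and at least
   half of the indices below [M] have the form [n k], because of the bound
   [n k <= 2 k]; here [m >= k0] takes care of the indices [k < k0]. *)
pose m := maxn k0 (Num.truncn (T / K)).+1.
pose M := (m.*2.+1 ^ N)%N; pose q := uphalf M.
pose t := K * m.+1%:R.
exists t.
  rewrite /t mulrC -ltr_pdivrMr//; apply: lt_trans (truncnS_gt _) _.
  by rewrite ltr_nat ltnS leq_max leqnn orbT.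
have t0 : 0 < t by rewrite mulr_gt0.
have Mm : (m.*2.+1 <= M)%N by rewrite /M -[X in (X <= _)%N]expn1 leq_pexp2l.
have nq k : (k < q)%N -> (n k < M)%N.
  rewrite /q => kq; have [k0k|kk0] := leqP k0 k.
    by have := n_k0 _ k0k; lia.
  have := n_mono _ _ kk0; have := n_k0 _ (leqnn k0).
  have := leq_maxl k0 (Num.truncn (T / K)).+1; rewrite -/m; lia.
have n_inj : injective n.
  move=> i j nij; have [ij|ji|//] := ltngtP i j.
    by have := n_mono _ _ ij; rewrite nij ltnn.
  by have := n_mono _ _ ji; rewrite nij ltnn.
have f_inj : injective (fun k => lpt A (v (n k))).
  by move=> i j /(lpt_inj uA iA)/(bij_inj v_bij)/n_inj.
pose X := [fset lpt A (v (n k)) | k in [fset k in iota 0 q]]%fset.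
have Xq : #|` X|%fset = q.
  by rewrite card_imfset// card_fseq undup_id ?iota_uniq// size_iota.
have XS : [set` X] `<=` [set lpt A (v (n k)) | k in [set: nat]] `&` box t.
  move=> x /= /imfsetP[k /=]; rewrite !inE mem_iota => kq ->.
  split; first by exists k.
  by apply: KA; apply: numbering_norm_le => //; exact: nq.
have := @counting_ge R _ _ _ XS; rewrite Xq => Xcount.
have V0 : 0 < box_volume N t by rewrite box_volumeE// exprn_gt0// pmulrn_lgt0.
apply: le_trans (_ : _ <= q%:R%:E * ((box_volume N t)^-1)%:E)%E _; last first.
  by apply: lee_wpmul2r => //; rewrite lee_fin invr_ge0 ltW.
rewrite -EFinM lee_fin ler_pdivlMr// box_volumeE//.
have -> : (t *+ 2) ^+ N = (K *+ 2) ^+ N * m.+1%:R ^+ N.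
  by rewrite -exprMn /t mulrnAl.
rewrite /c invfM mulrA divfK; last by rewrite gt_eqF// exprn_gt0// pmulrn_lgt0.
rewrite ler_pdivrMl//.
apply: (@le_trans _ _ M%:R).
  by rewrite -natrX ler_nat /M leq_exp2r//; lia.
by rewrite -natrM ler_nat /q; lia.
Qed.

End Density.

(** * Entropy of a fullshift *)

Section FullshiftEntropy.
Context {R : realType} {N : nat}.
Implicit Types (G L : closed_subset R N) (D S : set 'cV[R]_N).

(** Translating a point [x] of one set to the origin reveals that the other set
    does not contain [x]: it has then no point at all near the origin. *)
Lemma mdist_translate_ge D : uniformly_discrete D ->
  exists2 e, 0 < e & forall G1 G2 x, (G1 : set _) `<=` D -> (G2 : set _) `<=` D ->
    (G1 : set _) x -> ~ (G2 : set _) x ->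
    e <= mdist (hull_action x G1) (hull_action x G2).
Proof.
move=> [r r0 Dr].
have [e e0 eP] := closed_subset_dist_near (nbhs_enorm_lt (0 : 'cV[R]_N) r0).
exists e => // G1 G2 x G1D G2D G1x nG2x; rewrite leNgt; apply/negP => d12.
have [|y /= yr [z G2z zx]] := eP _ _ _ d12; first by exists x => //; rewrite subrr.
move: yr; rewrite -zx sub0r opprB ltNge => /negP; apply.
apply: Dr; [exact: G1D|exact: G2D|by move=> xz; apply: nG2x; rewrite xz].
Qed.

Lemma separation_number_ge (O : set (closed_subset R N)) (Xi : set (closed_subset R N))
    S e t (X : {fset 'cV[R]_N}) : Xi `<=` O ->
  (forall S', S' `<=` S -> exists2 G, Xi G & G `&` S = S') ->
  (forall G1 G2 x, Xi G1 -> Xi G2 -> (G1 : set _) x -> ~ (G2 : set _) x ->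
    e <= mdist (hull_action x G1) (hull_action x G2)) ->
  [set` X] `<=` S `&` box t ->
  (((2 ^ #|` X|%fset)%N%:R : R)%:E <= separation_number (@hull_action R N) O e t)%E.
Proof.
move=> XiO full sep XS.
have ex (Q : {fset 'cV[R]_N}) : exists G, [set` Q] `<=` S ->
    Xi G /\ G `&` S = [set` Q].
  have [QS|nQS] := pselect ([set` Q] `<=` S).
    by have [G XiG GS] := full _ QS; exists G.
  by exists (ClosedSubset set0 closed0).
have [g gP] := choice ex.
have XS' Q : Q \in fpowerset X -> [set` Q] `<=` S.
  by rewrite fpowersetE => /fsubsetP QX x /= /QX xX; have [] := XS x xX.
have g_inj : {in fpowerset X &, injective g}.
  move=> Q1 Q2 /XS' /gP[_ Q1E] /XS' /gP[_ Q2E] g12.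
  by rewrite -(set_fsetK Q1) -(set_fsetK Q2) -Q1E -Q2E g12.
have -> : (2 ^ #|` X|)%N = #|` [fset g Q | Q in fpowerset X]|%fset.
  by rewrite card_in_imfset//= card_fpowerset.
set Y := [fset g Q | Q in fpowerset X]%fset.
apply: (@le_trans _ _ (counting [set` Y])); first exact: counting_ge.
apply: ereal_sup_ubound; exists [set` Y] => //; split.
  by move=> _ /= /imfsetP[Q /= QX ->]; apply: XiO; have [] := gP _ (XS' _ QX).
have sep' Q1 Q2 x : Q1 \in fpowerset X -> Q2 \in fpowerset X -> x \in Q1 ->
    x \notin Q2 -> box t x /\ e <= mdist (hull_action x (g Q1)) (hull_action x (g Q2)).
  move=> QX1 QX2 xQ1 xQ2; have [Xi1 Q1E] := gP _ (XS' _ QX1).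
  have [Xi2 Q2E] := gP _ (XS' _ QX2).
  have xX : x \in X by move: QX1; rewrite fpowersetE => /fsubsetP; apply.
  have [xS xt] := XS x xX; split => //; apply: sep => //.
    by have : [set` Q1] x by []; rewrite -Q1E => -[].
  move=> g2x; move/negP: xQ2; apply.
  by have : [set` Q2] x by rewrite -Q2E.
move=> _ _ /= /imfsetP[Q1 /= QX1 ->] /imfsetP[Q2 /= QX2 ->] g12.
have : Q1 != Q2 by apply/eqP => Q12; apply: g12; rewrite Q12.
rewrite eqEfsubset negb_and => /orP[] /fsubsetPn[x x1 x2].
  by have [xt h] := sep' _ _ _ QX1 QX2 x1 x2; exists x.
have [xt h] := sep' _ _ _ QX2 QX1 x1 x2; exists x => //.
by rewrite metric_sym.
Qed.

(** The [2 ^ n] patterns on the [n] points of [S] in a box yield that many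
    separated points of the hull, so the entropy is at least [ln 2] times the
    upper density of [S]. *)
Lemma fullshift_entropy_gt0 D Xi S : embedded_fullshift D Xi S ->
  (0 < topological_entropy (@hull_action R N) (hull D))%E.
Proof.
move=> [XiO cXi dS dXi full].
have [e e0 eP] := mdist_translate_ge dXi.
have [c c0 cS] : exists2 c : R, 0 < c & (c%:E < upper_density S)%E.
  move: dS; case: upper_density => [r| |]//; last by exists 1 => //; rewrite ltry.
  by rewrite lte_fin => r0; exists (r / 2); rewrite ?lte_fin; lra.
have ln20 : 0 < ln 2 :> R by rewrite ln_gt0//; lra.
apply: (@lt_le_trans _ _ (c * ln 2)%:E); first by rewrite lte_fin mulr_gt0.
apply: le_trans (ereal_sup_ubound _); last by exists e.
apply: limf_esup_pinfty_ge => T.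
have [t + ct] := limf_esup_pinfty_gt cS (Num.max T 0).
rewrite gt_max => /andP[Tt t0]; exists t => //.
have V0 : 0 < box_volume N t by rewrite box_volumeE// exprn_gt0// pmulrn_lgt0.
have [X XS cX] : exists2 X : {fset 'cV[R]_N}, [set` X] `<=` S `&` box t &
    c * box_volume N t < #|` X|%fset%:R.
  apply: counting_gt_fset; move: ct.
  by rewrite lte_pdivlMr.
have sepX : (((2 ^ #|` X|%fset)%N%:R : R)%:E <=
    separation_number (@hull_action R N) (hull D) e t)%E.
  apply: (separation_number_ge XiO full) XS.
  by move=> G1 G2 x X1 X2; apply: eP => y Gy; [exists G1|exists G2].
have p0 : 0 < (2 ^ #|` X|%fset)%N%:R :> R by rewrite ltr0n expn_gt0.
apply: (@le_trans _ _ (((box_volume N t)^-1)%:E * lne (2 ^ #|` X|%fset)%N%:R%:E)%E).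
  rewrite lne_EFin// -EFinM lee_fin natrX lnXn// ler_pdivlMl// -[leRHS]mulr_natl.
  by rewrite mulrA ler_pM2r// mulrC ltW.
apply: lee_wpmul2l; first by rewrite lee_fin invr_ge0 ltW.
have p0' : (0 <= (2 ^ #|` X|%fset)%N%:R%:E :> \bar R)%E by rewrite lee_fin ltW.
by rewrite lee_lne// in_itv/= leey andbT// (le_trans p0').
Qed.

End FullshiftEntropy.

(** * Patterns and the window *)

Section FullshiftFromPatterns.
Context {R : realType} {N : nat}.

(** Translates that show longer and longer initial pieces of an infinite pattern
    accumulate, inside the locally finite set [D], at a member of the hull that
    shows the whole pattern. *)
Lemma embedded_fullshift_patterns (L D : set 'cV[R]_N) (s : nat -> 'cV[R]_N) :
  uniformly_discrete D -> (forall t, finite_set (D `&` box t)) ->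
  (0 < upper_density (range s))%E ->
  (forall m (b : nat -> bool), exists x, translate x L `<=` D /\
    forall k, (k < m)%N -> (translate x L (s k) <-> b k)) ->
  exists Xi, embedded_fullshift L Xi (range s).
Proof.
move=> dD fD S0 pat.
have cD D' : D' `<=` D -> closed D'.
  by move=> D'D; apply: closed_uniformly_discrete; exact: uniformly_discreteS dD.
exists (hull L `&` [set G : closed_subset R N | (G : set _) `<=` D]); split => //.
- by apply: closedI; [exact: closed_closure|exact: closed_sub_closed_subsets (cD _ _)].
- by apply: uniformly_discreteS dD => x [G [_ GD]]; exact: GD.
move=> S' S'S; pose b k := `[< S' (s k) >].
have [x xP] := choice (fun m => pat m b).
pose G m := ClosedSubset (translate (x m) L) (cD _ (xP m).1).
have [m|m|K [KL KD Kb]] := @ultralimit_closed_subset R N D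
  [set G : closed_subset R N | exists s, G = translate s L :> set _] G cD fD.
- by exists (x m).
- exact: (xP m).1.
have Ks k : (K : set _) (s k) <-> b k.
  by apply: Kb; exists k.+1 => // m /= km; exact: (xP m).2.
exists K => //; apply/seteqP; split => [y [Ky [k _ sk]]|y S'y].
  by move: Ky; rewrite -sk => /Ks/asboolP.
have [k _ sk] := S'S _ S'y; split; last by exists k.
by move: S'y; rewrite -sk => ?; apply/Ks/asboolP.
Qed.

End FullshiftFromPatterns.

Section AlmostEveryPattern.
Context {R : realType}.
Local Notation mu := (@lebesgue_measure R).

Lemma ae_forall_countType (T : countType) (P : T -> R -> Prop) :
  (forall t, {ae mu, forall x, P t x}) -> {ae mu, forall x, forall t, P t x}.
Proof.
move=> aeP; have : {ae mu, forall x, forall k,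
    if @choice.unpickle T k is Some t then P t x else True}.
  by apply: ae_foralln => k; case: choice.unpickle => [t|]; [exact: aeP|exact: aeW].
apply: (@filterS _ _ (ae_filter_ringOfSetsType mu)) => x Px t.
by have := Px (choice.pickle t); rewrite choice.pickleK.
Qed.

(** Finite patterns are countably many, so that almost every [theta] serves all
    of them at once. *)
Lemma ae_lattice_pattern (N : nat) (A : 'M[R]_(N + 1)) (As : nat -> set R)
    (e : nat -> R) :
  dense [set pi2 x | x in lattice A] ->
  (forall k, lebesgue_measurable (As k)) -> (forall k, As k `<=` `[0, 1]) ->
  locally_metrically_independent0 As -> (forall m, 0 < e m) ->
  {ae mu, forall theta, forall m (b : nat -> bool), exists l,
    [/\ lattice A l, 0 < pi2 l - theta < e m &
      forall k, (k < m)%N -> (As k (pi2 l - theta) <-> b k)]}.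
Proof.
move=> dA mAs sAs iAs e0.
pose g (z : 'cV[int]_(N + 1)) := pi2 (A *m map_mx intr z).
have dg : dense (range g).
  rewrite (_ : range g = [set pi2 x | x in lattice A])//.
  by rewrite /lattice image_comp.
have := @ae_forall_countType (nat * seq bool)%type (fun mb theta => exists z,
  0 < g z - theta < e mb.1 /\
  forall k, (k < mb.1)%N -> (As k (g z - theta) <-> nth false mb.2 k)).
move=> H; apply: (@filterS _ _ (ae_filter_ringOfSetsType mu) _ _ _ (H _))
  => [theta tP m b|[m b]] /=.
  have [z [ze zP]] := tP (m, mkseq b m); exists (A *m map_mx intr z).
  split => //; first by exists z.
  by move=> k km; have := zP _ km; rewrite nth_mkseq.
have [B [mB B0 BP]] := borel_pattern_pos (nth false b) m mAs sAs iAs (e0 m).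
apply: (@filterS _ _ (ae_filter_ringOfSetsType mu) _ _ _
  (ae_dense_reflection dg mB B0)) => theta [z Bz].
by exists z; exact: BP.
Qed.

End AlmostEveryPattern.

Section Window.
Context {R : realType}.
Implicit Types (I As : nat -> set R).

Lemma window_sub01 I As : closure (\bigcup_k I k) = `[0, 1]%classic ->
  window I As `<=` `[0, 1].
Proof.
move=> cI x [[]//|[k _ [Ik _]]]; rewrite -cI; apply: subset_closure.
by exists k.
Qed.

(** The point [l + u] lies in the gap [I k] and in no other gap, so that only the
    copy of [As k] placed in this gap decides whether it is in the window. *)
Lemma window_gap I As k (l e u : R) : (forall j, j <> k -> I j `&` I k = set0) ->
  I k = `]l, l + e[%classic -> 0 < u < e -> window I As (l + u) <-> As k u.
Proof.
move=> disj Ik ue.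
have Iu : I k (l + u) by rewrite Ik /= in_itv/=; lra.
have infI : inf (I k) = l by rewrite Ik inf_itv// bnd_simp; lra.
split => [[[_ []]|[j _ [Iju [w Aw wu]]]]|Au].
- by exists k.
- have [jk|jk] := pselect (j = k).
    by move: wu Aw; rewrite jk infI addrC => /addrI <-.
  by have : (I j `&` I k) (l + u) by []; rewrite disj.
- by right; exists k => //; split => //; exists u => //; rewrite infI addrC.
Qed.

End Window.

Lemma ratio_limn_gt (R : realType) (n : nat -> nat) :
  cvgn (fun k : nat => k%:R / (n k)%:R : R) ->
  2^-1 < limn (fun k : nat => k%:R / (n k)%:R : R) ->
  exists k0, forall k, (k0 <= k)%N -> (n k <= k.*2)%N.
Proof.
move=> /cvgrPdist_lt cv lim; pose r := limn (fun k : nat => k%:R / (n k)%:R : R).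
have r0 : 0 < r - 2^-1 by rewrite subr_gt0.
have [k0 _ k0P] := cv _ r0; exists k0 => k k0k.
have := k0P k k0k; rewrite /= -/r => /ltr_normlW; rewrite ltrBlDr -ltrBlDl subKr.
have [->//|nk0] := posnP (n k).
rewrite ltr_pdivlMr ?ltr0n// ltr_pdivrMl// -natrM ltr_nat; lia.
Qed.

Theorem theorem7p2 (R : realType) (N : nat) (A : 'M[R]_(N + 1))
  (v : nat -> 'cV[int]_N) (n : nat -> nat) (eps : nat -> R)
  (I : nat -> set R) (As : nat -> set R)
  (hN : (1 <= N)%N)
  (hA : cut_and_project_scheme A)
  (hA_row : forall j : 'I_N, 0 < A (rshift N 0) (lshift 1 j) < 1)
  (hA_corner : A (rshift N 0) (rshift N 0) = 1)
  (hv_bij : bijective v)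
  (hv_mono : forall i j, (i <= j)%N -> (int_supnorm (v i) <= int_supnorm (v j))%N)
  (hn : forall i j, (i < j)%N -> (n i < n j)%N)
  (heps : forall k, 0 < eps k)
  (hI : forall k, I k = `]lstar A (v (n k)), lstar A (v (n k)) + eps k[%classic)
  (hI_disj : forall j k, j <> k -> I j `&` I k = set0)
  (hI_cl : closure (\bigcup_k I k) = `[0, 1]%classic)
  (hn_cvg : cvgn (fun k : nat => k%:R / (n k)%:R : R))
  (hn_lim : 2^-1 < limn (fun k : nat => k%:R / (n k)%:R : R))
  (hAs_meas : forall k, lebesgue_measurable (As k))
  (hAs_sub : forall k, As k `<=` `[0, 1]%classic)
  (hAs_bdry : forall k, cantor_ternary R `<=` boundary (As k))
  (hAs_int : forall k, interior (As k) = set0)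
  (hAs_ind : locally_metrically_independent0 As) :
  let W := window I As in
  let S := [set lpt A (v (n k)) | k in [set: nat]] in
  {ae (@lebesgue_measure R), forall theta : R,
    let Lambda := model_set A (shift_set W theta) in
    (exists Xi, embedded_fullshift Lambda Xi S) /\
    (0 < topological_entropy (@hull_action R N) (hull Lambda))%E}.
Proof.
move=> W S; have [uA iA dA] := hA.
have [k0 k0P] := ratio_limn_gt hn_cvg hn_lim.
(* Moving by less than [e m] keeps each of the first [m] points in its gap. *)
pose e m : R := \big[Num.min/1]_(k < m) eps k.
have e0 m : 0 < e m.
  by apply: (big_ind (fun r => 0 < r)) => // a b a0 b0; rewrite lt_min a0.
have e1 m : e m <= 1 by exact: bigmin_le_id.
have e_eps m k : (k < m)%N -> e m <= eps k.
  move=> km; exact: (bigmin_le 1 (Ordinal km) (fun k : 'I_m => eps k)).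
have W01 : W `<=` `[0, 1] by exact: window_sub01.
(* [D] contains all the translates in question: they are the model sets of the
   windows [W - u] with [0 < u < 1]. *)
pose D := model_set A `[-1, 1].
have dD : uniformly_discrete D by exact: (@uniformly_discrete_model_set _ _ _ hA _ 1).
have fD t : finite_set (D `&` box t) by exact: (@finite_model_set_box _ _ _ hA _ 1).
apply: (@filterS _ _ (ae_filter_ringOfSetsType (@lebesgue_measure R)) _ _ _
  (ae_lattice_pattern dA hAs_meas hAs_sub hAs_ind e0)) => theta pat /=.
set Lambda := model_set A (shift_set W theta).
suff [Xi XiP] : exists Xi, embedded_fullshift Lambda Xi S.
  by split; [exists Xi|exact: fullshift_entropy_gt0 XiP].
apply: embedded_fullshift_patterns dD fD _ _.
  exact: (upper_density_lpt hN uA iA hA_corner hv_bij hv_mono hn k0P).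
move=> m b; have [l [lA ul lP]] := pat m b; exists (pi1 l).
set u := pi2 l - theta in ul lP.
have {}ul : 0 < u /\ u < e m by apply/andP.
have -> : translate (pi1 l) Lambda = model_set A (shift_set W (- u)).
  rewrite translate_model_set//; congr model_set; apply/seteqP.
  split => [_ [_ [w Ww <-] <-]|_ [w Ww <-]].
    by exists w => //; rewrite /u; ring.
  by exists (w + theta); [exists w|rewrite /u; ring].
split.
  apply: model_setS => _ [w /W01 + <-]; have := e1 m; rewrite /= !in_itv/=; lra.
move=> k km; apply: iff_trans (lP k km).
have uk : 0 < u < eps k by have := e_eps _ _ km; lra.
apply: iff_trans (window_gap As (fun j jk => hI_disj j k jk) (hI k) uk).
split => [[x [xA [w Ww wx]] /iA xl]|Wu].
  have <- : w = lstar A (v (n k)) + u; last by [].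
  rewrite /lstar -xl ?inE//; last exact: lattice_lattice_point.
  by rewrite -wx addrNK.
exists (lattice_point A (v (n k)) (last_coord A (v (n k)))) => //.
split; first exact: lattice_lattice_point.
by exists (lstar A (v (n k)) + u) => //; rewrite addrK.
Qed.
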